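(* Let $\rho,\mu,g,v,K>0$ and $0<r_{\min}<r_{\max}<\infty$ be constants and let $\mathcal{F}$ be a positive continuous sea spray generation function supported on $[r_{\min},r_{\max}]$. For each $w>0$ and each $r\in[r_{\min},r_{\max}]$ let $z_t(r,w)$ be the solution on $0\le t<r^2/K$ of $$z_t''=-g+\frac{1}{\tau_t}(w-z_t'),\qquad z_0=0,\quad z_0'=v,\qquad \tau_t=\frac{2\rho(r^2-Kt)}{9\mu},$$ and let $z^{**}=z^{**}(w)$ be the maximum height reached by any droplet with initial radius in $[r_{\min},r_{\max}]$, as defined in the context. Then $$\lim_{w\to\infty}\frac{z^{**}(w)}{w}=\frac{9\mu}{9\mu+2\rho K}\cdot\frac{r_{\max}^2}{K}.$$
   Context: Here $w$ is the vertical wind speed and $v$ the initial velocity, and a droplet of initial radius $r$ has radius $r_t$ with $r_t^2=r^2-Kt$, $0\le t\le r^2/K$. The duration $\zeta(r,w)$ is the smallest root of $z_t(r,w)=0$ in $(0,r^2/K)$ if one exists, and $r^2/K$ otherwise. The maximum height reached by any droplet is $$z^{**}(w)=\sup\{z_t(r,w)\mid r_{\min}\le r\le r_{\max},\ 0\le t<\zeta(r,w)\}.$$ (The solution $z_t(r,w)$ extends continuously to $t=r^2/K$, so this is the maximum of the trajectory heights over the closed flight intervals.) The function $\mathcal{F}$ enters only through its support $[r_{\min},r_{\max}]$. *)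

(* Defs.v *)
From Stdlib Require Import Reals.
From Coquelicot Require Import Coquelicot.

Open Scope R_scope.

Definition relaxation_time (rho mu K r t : R) : R :=
  2 * rho * (r ^ 2 - K * t) / (9 * mu).

Definition lifetime (K r : R) : R := r ^ 2 / K.

Definition life_interval (K r t : R) : Prop := 0 <= t < lifetime K r.

(* [dh] is the velocity.  [D_in] is the derivative relative to the half-open
   interval [0, r^2/K), hence two-sided in the interior and one-sided at 0;
   nothing is required of [h] outside that interval. *)
Definition is_trajectory (rho mu g v K r w : R) (h : R -> R) : Prop :=
  exists dh : R -> R,
    h 0 = 0 /\ dh 0 = v /\
    forall t, life_interval K r t ->
      D_in h dh (life_interval K r) t /\
      D_in dh
        (fun s => - g + 1 / relaxation_time rho mu K r s * (w - dh s))
        (life_interval K r) t.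

Definition flight_root (K r : R) (h : R -> R) (t : R) : Prop :=
  0 < t < lifetime K r /\ h t = 0.

Definition is_duration (K r : R) (h : R -> R) (zeta : R) : Prop :=
  (flight_root K r h zeta /\ forall t, flight_root K r h t -> zeta <= t) \/
  ((~ exists t, flight_root K r h t) /\ zeta = lifetime K r).

(* [z r w t] is the height at time [t] of the droplet of initial radius [r]
   in wind [w]. *)
Definition reached_height (K rmin rmax : R) (z : R -> R -> R -> R)
    (w x : R) : Prop :=
  exists r zeta t,
    rmin <= r <= rmax /\ is_duration K r (z r w) zeta /\
    0 <= t < zeta /\ x = z r w t.

(* The supremum is taken in the extended reals, so a value [real p_infty = 0]
   would only occur for an unbounded set of heights; a nonzero limit of
   [max_height w / w] therefore includes boundedness for all large [w]. *)
Definition max_height (K rmin rmax : R) (z : R -> R -> R -> R) (w : R) : R :=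
  real (Lub_Rbar (reached_height K rmin rmax z w)).

(* Positivity is asked only inside the interval and continuity only relative
   to it, so that [F] may either vanish or jump at the endpoints. *)
Definition is_generation_function (rmin rmax : R) (F : R -> R) : Prop :=
  continuous_on (fun r => rmin <= r <= rmax) F /\
  (forall r, rmin < r < rmax -> 0 < F r) /\
  (forall r, ~ (rmin <= r <= rmax) -> F r = 0).

(* Main.v *)
(** With [T = r^2/K] and [a = 9 mu / (2 rho K)] the equation reads
    [z'' = - g + a / (T - t) * (w - z')].  It has the first integral
    [(T - t) z' + (a + 1) z = T v + a w t - g (T t - t^2 / 2)].
    The integrating factor [(T - t)^(-a)] gives [0 < z' <= w] as soon as
    [g T < a w] and [v <= w]; hence the droplet does not return to height 0
    before time [T].  The first integral then gives
    [(a + 1) z <= T v + a w T] for such [w], and at time [T - T / w] it gives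
    [a w T - O(1) <= (a + 1) z].  Taking [r = rmax] in the lower bound shows
    that [z^** / w] differs from [a T / (a + 1)] by [O(1/w)]. *)
Require Import Defs.
From Stdlib Require Import Reals Lra.
From Coquelicot Require Import Coquelicot.

Open Scope R_scope.

(** * From derivatives relative to [[0, T)] to two-sided ones *)

(** Composing with [Rmax 0] freezes [f] at [f 0] on negative arguments, so that one-sided continuity
    at 0 becomes the two-sided continuity that the mean value theorem asks for. *)
Lemma D_in_continuity_pt_Rmax (f df : R -> R) (T t : R) :
  D_in f df (fun x => 0 <= x < T) t -> 0 <= t < T ->
  continuity_pt (fun x => f (Rmax 0 x)) t.
Proof.
intros H Ht.
apply cont_deriv in H.
intros e He.
destruct (H e He) as [d [Hd HH]].
exists (Rmin d (T - t)); split.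
{ apply Rmin_glb_lt; lra. }
intros x [_ Hx]; cbn in *; unfold Rdist in *.
assert (Hx1 := Rlt_le_trans _ _ _ Hx (Rmin_l _ _)).
assert (Hx2 := Rlt_le_trans _ _ _ Hx (Rmin_r _ _)).
apply Rabs_def2 in Hx1; apply Rabs_def2 in Hx2.
rewrite (Rmax_right 0 t) by lra.
(* The limit behind [D_in] says nothing at the base point itself, which [Rmax 0 x] hits for every
   [x <= 0] when [t = 0]. *)
destruct (Req_dec t (Rmax 0 x)) as [E|E].
- rewrite <- E, Rminus_diag, Rabs_R0; exact He.
- apply HH; split; [split; [|exact E]|].
  + split; [apply Rmax_l | apply Rmax_lub_lt; lra].
  + destruct (Rle_dec 0 x) as [Hp|Hp].
    * rewrite Rmax_right by lra; apply Rabs_def1; lra.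
    * rewrite Rmax_left by lra; apply Rabs_def1; lra.
Qed.

Lemma D_in_is_derive_Rmax (f df : R -> R) (T t : R) :
  D_in f df (fun x => 0 <= x < T) t -> 0 < t < T ->
  is_derive (fun x => f (Rmax 0 x)) t (df t).
Proof.
intros H Ht.
apply is_derive_Reals.
intros e He.
destruct (H e He) as [d [Hd HH]].
assert (Hpos : 0 < Rmin d (Rmin t (T - t))).
{ repeat apply Rmin_glb_lt; lra. }
exists (mkposreal _ Hpos); intros y Hy0 Hy; simpl in Hy.
assert (Hy1 := Rlt_le_trans _ _ _ Hy (Rmin_l _ _)).
assert (Hy' := Rlt_le_trans _ _ _ Hy (Rmin_r _ _)).
assert (Hy2 := Rlt_le_trans _ _ _ Hy' (Rmin_l _ _)).
assert (Hy3 := Rlt_le_trans _ _ _ Hy' (Rmin_r _ _)).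
apply Rabs_def2 in Hy2; apply Rabs_def2 in Hy3.
rewrite !Rmax_right by lra.
specialize (HH (t + y)); cbn in HH; unfold Rdist in HH.
replace (t + y - t) with y in HH by ring.
apply HH; split; [split; lra | exact Hy1].
Qed.

Lemma increment_MVT (f df : R -> R) (T t : R) :
  (forall x, 0 <= x < T -> continuity_pt f x) ->
  (forall x, 0 < x < T -> is_derive f x (df x)) ->
  0 <= t < T -> exists c, 0 <= c <= t /\ f t - f 0 = df c * t.
Proof.
intros Hc Hd Ht.
destruct (MVT_gen f 0 t df) as [c [H1 H2]].
- intros x; rewrite Rmin_left, Rmax_right by lra; intros Hx; apply Hd; lra.
- intros x; rewrite Rmin_left, Rmax_right by lra; intros Hx; apply Hc; lra.
- rewrite Rmin_left, Rmax_right in H1 by lra.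
  exists c; split; [exact H1 | rewrite H2; ring].
Qed.

(** [h] and [p] stand for the height and the velocity, extended by constants to
    negative times. *)
Definition droplet_motion (a T g v w : R) (h p : R -> R) : Prop :=
  h 0 = 0 /\ p 0 = v /\
  (forall t, 0 <= t < T -> continuity_pt h t /\ continuity_pt p t) /\
  (forall t, 0 < t < T -> is_derive h t (p t) /\
     is_derive p t (- g + a / (T - t) * (w - p t))).

Lemma trajectory_droplet_motion (rho mu g v K r w : R) (h : R -> R) :
  0 < rho -> 0 < mu -> 0 < K ->
  is_trajectory rho mu g v K r w h ->
  exists p, droplet_motion (9 * mu / (2 * rho * K)) (lifetime K r) g v w
              (fun t => h (Rmax 0 t)) p.
Proof.
intros Hrho Hmu HK [dh [H0 [H1 H]]].
exists (fun t => dh (Rmax 0 t)).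
split; [|split; [|split]].
- now rewrite Rmax_left by lra.
- now rewrite Rmax_left by lra.
- intros t Ht; split.
  + exact (D_in_continuity_pt_Rmax _ _ (lifetime K r) t (proj1 (H t Ht)) Ht).
  + exact (D_in_continuity_pt_Rmax _ _ (lifetime K r) t (proj2 (H t Ht)) Ht).
- intros t Ht.
  assert (Ht' : 0 <= t < lifetime K r) by lra.
  destruct (H t Ht') as [D1 D2].
  apply (fun D => D_in_is_derive_Rmax _ _ _ _ D Ht) in D1, D2.
  rewrite (Rmax_right 0 t) by lra.
  split; [exact D1|].
  (* Since [r ^ 2 - K * t = K * (lifetime K r - t)], the inverse relaxation time is [a / (T - t)],
     with [a] independent of [r]. *)
  replace (- g + 9 * mu / (2 * rho * K) / (lifetime K r - t) * (w - dh t))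
    with (- g + 1 / relaxation_time rho mu K r t * (w - dh t)); [exact D2|].
  do 2 f_equal; unfold relaxation_time.
  replace (r ^ 2 - K * t) with (K * (lifetime K r - t))
    by (unfold lifetime; field; lra).
  field; repeat split; lra.
Qed.

(** * Velocity and height of a single droplet *)

Section Motion.

Context (a T g v w : R) (h p : R -> R).
Context (HT : 0 < T) (Hg : 0 < g) (Hv : 0 < v).
Context (Hm : droplet_motion a T g v w h p).

(** The equation times [T - t] reads [((T - t) p)' + (a + 1) h' = a w - g (T - t)], and both sides
    are exact derivatives. *)
Lemma first_integral (t : R) : 0 <= t < T ->
  (T - t) * p t + (a + 1) * h t = T * v + a * w * t - g * (T * t - t ^ 2 / 2).
Proof.
destruct Hm as [H0 [H1 [Hc Hd]]]; intros Ht.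
destruct (increment_MVT
  (fun t => (T - t) * p t + (a + 1) * h t - a * w * t + g * (T * t - t ^ 2 / 2))
  (fun _ => 0) T t) as [c [_ E]].
- intros x Hx; destruct (Hc x Hx).
  reg.
- intros x Hx; destruct (Hd x Hx) as [D1 D2].
  auto_derive.
  + repeat split; eexists; eassumption.
  + change (fun y : R => p y) with p; change (fun y : R => h y) with h.
    rewrite (is_derive_unique _ _ _ D2), (is_derive_unique _ _ _ D1).
    field; lra.
- exact Ht.
- cbn beta in E; rewrite H0, H1 in E; lra.
Qed.

(** The equation gives [(p - b)' + a / (T - t) * (p - b) = - g + a / (T - t) * (w - b)], and the
    exponential is the integrating factor [(T - t)^(-a)]. Only the sign of the right-hand side
    matters later: [b = 0] and [b = w] give the two velocity bounds. *)
Lemma integrating_factor_increment (b t : R) : 0 <= t < T ->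
  exists c, 0 <= c <= t /\
    exp (- a * ln (T - t)) * (p t - b) - exp (- a * ln T) * (v - b)
    = exp (- a * ln (T - c)) * (- g + a / (T - c) * (w - b)) * t.
Proof.
destruct Hm as [H0 [H1 [Hc Hd]]]; intros Ht.
destruct (increment_MVT
  (fun t => exp (- a * ln (T - t)) * (p t - b))
  (fun t => exp (- a * ln (T - t)) * (- g + a / (T - t) * (w - b))) T t)
  as [c [Hct E]].
- intros x Hx; destruct (Hc x Hx).
  apply (continuity_pt_mult (fun t => exp (- a * ln (T - t))) (fun t => p t - b)).
  + apply continuity_pt_filterlim.
    apply (ex_derive_continuous (fun t => exp (- a * ln (T - t)))).
    auto_derive; lra.
  + reg.
- intros x Hx; destruct (Hd x Hx) as [D1 D2].
  auto_derive.
  + repeat split; [lra | eexists; eassumption].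
  + change (fun y : R => p y) with p; rewrite (is_derive_unique _ _ _ D2).
    unfold Rminus; field; lra.
- exact Ht.
- exists c; split; [exact Hct|].
  cbn beta in E; rewrite H1, Rminus_0_r in E; exact E.
Qed.

Lemma velocity_pos (t : R) : g * T < a * w -> 0 <= t < T -> 0 < p t.
Proof.
intros Hw Ht.
destruct (integrating_factor_increment 0 t Ht) as [c [Hct E]].
assert (E1 := exp_pos (- a * ln (T - t))).
assert (E2 := exp_pos (- a * ln T)).
assert (E3 := exp_pos (- a * ln (T - c))).
assert (0 <= - g + a / (T - c) * (w - 0)).
{ replace (- g + a / (T - c) * (w - 0)) with ((a * w - g * (T - c)) / (T - c))
    by (field; lra).
  apply Rdiv_le_0_compat; [nra | lra]. }
assert (0 <= exp (- a * ln (T - c)) * (- g + a / (T - c) * (w - 0)) * t).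
{ repeat apply Rmult_le_pos; lra. }
assert (0 < exp (- a * ln T) * (v - 0)) by (apply Rmult_lt_0_compat; lra).
apply (Rmult_lt_reg_l _ _ _ E1); lra.
Qed.

Lemma velocity_le_wind (t : R) : v <= w -> 0 <= t < T -> p t <= w.
Proof.
intros Hw Ht.
destruct (integrating_factor_increment w t Ht) as [c [Hct E]].
assert (E1 := exp_pos (- a * ln (T - t))).
assert (E2 := exp_pos (- a * ln T)).
assert (E3 := exp_pos (- a * ln (T - c))).
(* For [b = w] the drag term vanishes and only gravity is left, so the weighted [p - w] decreases
   from a nonpositive value. *)
rewrite Rminus_diag, Rmult_0_r, Rplus_0_r in E.
assert (0 <= exp (- a * ln (T - c)) * g * t).
{ repeat apply Rmult_le_pos; lra. }
assert (0 <= exp (- a * ln T) * (w - v)) by (apply Rmult_le_pos; lra).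
apply Rminus_le, (Rmult_le_reg_l _ _ _ E1); lra.
Qed.

Lemma height_pos (t : R) : g * T < a * w -> 0 < t < T -> 0 < h t.
Proof.
intros Hw Ht.
destruct Hm as [H0 [H1 [Hc Hd]]].
destruct (increment_MVT h p T t) as [c [Hct E]].
- intros x Hx; now apply Hc.
- intros x Hx; now apply Hd.
- lra.
- rewrite H0, Rminus_0_r in E; rewrite E.
  apply Rmult_lt_0_compat; [apply velocity_pos|]; lra.
Qed.

Lemma height_upper_bound (t : R) :
  g * T < a * w -> 0 < w -> 0 <= t < T -> (a + 1) * h t <= T * v + a * w * T.
Proof.
intros Hgw Hw Ht.
assert (E := first_integral t Ht).
assert (Hp := velocity_pos t Hgw Ht).
assert (0 <= (T - t) * p t) by (apply Rmult_le_pos; lra).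
assert (0 <= g * (T * t - t ^ 2 / 2)) by (apply Rmult_le_pos; nra).
assert (a * w * t <= a * w * T) by (apply Rmult_le_compat_l; nra).
lra.
Qed.

(** Stopping [T / w] before the end keeps both losses bounded in [w]: [(T - t) p] is at most
    [T / w * w = T], and [a w t] falls short of [a w T] by exactly [a T]. *)
Lemma height_lower_bound :
  v <= w -> 1 < w ->
  a * w * T - (a * T + g * T ^ 2 + T) <= (a + 1) * h (T - T / w).
Proof.
intros Hvw Hw.
assert (Hs : 0 < T / w) by (apply Rdiv_lt_0_compat; lra).
assert (Hs' : T / w * w = T) by (field; lra).
assert (Hs1 : T / w < T) by nra.
assert (Ht : 0 <= T - T / w < T) by lra.
assert (E := first_integral _ Ht).
assert (Hp := velocity_le_wind _ Hvw Ht).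
assert ((T - (T - T / w)) * p (T - T / w) <= T).
{ replace (T - (T - T / w)) with (T / w) by ring.
  apply Rle_trans with (T / w * w); [|lra].
  apply Rmult_le_compat_l; lra. }
assert (g * (T * (T - T / w) - (T - T / w) ^ 2 / 2) <= g * T ^ 2)
  by (apply Rmult_le_compat_l; nra).
replace (a * w * (T - T / w)) with (a * w * T - a * T) in E by (field; lra).
nra.
Qed.

End Motion.

(** * Supremum over all droplets and the limit *)

Lemma lifetime_pos (K r : R) : 0 < K -> 0 < r -> 0 < lifetime K r.
Proof.
intros HK Hr; unfold lifetime; apply Rdiv_lt_0_compat; [nra | exact HK].
Qed.

Lemma lifetime_le (K r s : R) :
  0 < K -> 0 < r <= s -> lifetime K r <= lifetime K s.
Proof.
intros HK Hr; unfold lifetime, Rdiv; apply Rmult_le_compat_r.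
- apply Rlt_le, Rinv_0_lt_compat, HK.
- apply pow_incr; lra.
Qed.

Lemma is_duration_le_lifetime (K r zeta : R) (h : R -> R) :
  is_duration K r h zeta -> zeta <= lifetime K r.
Proof. intros [[[H _] _]|[_ ->]]; lra. Qed.

(** The element [x] excludes the supremum [m_infty] and the bound [M] excludes [p_infty], so [real]
    never returns its default 0. *)
Lemma real_Lub_Rbar_bounds (E : R -> Prop) (x m M : R) :
  E x -> m <= x -> (forall y, E y -> y <= M) -> m <= real (Lub_Rbar E) <= M.
Proof.
intros Ex Hmx HM.
destruct (Lub_Rbar_correct E) as [H1 H2].
assert (A := H1 x Ex).
assert (B := H2 (Finite M) (fun y Ey => HM y Ey)).
destruct (Lub_Rbar E) as [l| |]; simpl in *; [lra | easy | easy].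
Qed.

Lemma is_lim_p_infty_of_bounds_inv (f : R -> R) (l c C w0 : R) :
  (forall w, w0 < w -> l + c * / w <= f w <= l + C * / w) ->
  is_lim f p_infty l.
Proof.
intros H.
assert (A : forall k, is_lim (fun w => l + k * / w) p_infty l).
{ intros k.
  replace (Finite l) with (Finite (l + k * 0)) by (f_equal; ring).
  apply (is_lim_plus' _ (fun w => k * / w)); [apply is_lim_const|].
  apply (is_lim_scal_l (fun w => / w) k p_infty 0).
  apply (is_lim_inv (fun w => w) p_infty p_infty); [apply is_lim_id | easy]. }
apply (is_lim_le_le_loc (fun w => l + c * / w) (fun w => l + C * / w)).
- exists w0; exact H.
- apply A.
- apply A.
Qed.

Theorem mainTheorem5
  (rho mu g v K rmin rmax : R)
  (Hrho : 0 < rho) (Hmu : 0 < mu) (Hg : 0 < g) (Hv : 0 < v) (HK : 0 < K)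
  (Hrmin : 0 < rmin) (Hrmax : rmin < rmax)
  (F : R -> R) (HF : is_generation_function rmin rmax F)
  (z : R -> R -> R -> R)
  (Hz : forall w r : R, 0 < w -> rmin <= r <= rmax ->
        is_trajectory rho mu g v K r w (z r w)) :
  is_lim (fun w => max_height K rmin rmax z w / w) p_infty
    (Finite (9 * mu / (9 * mu + 2 * rho * K) * (rmax ^ 2 / K))).
Proof.
set (a := 9 * mu / (2 * rho * K)).
assert (Ha : 0 < a).
{ apply Rdiv_lt_0_compat; [lra|]; repeat apply Rmult_lt_0_compat; lra. }
set (T := lifetime K rmax).
assert (HT : 0 < T) by (apply lifetime_pos; lra).
replace (9 * mu / (9 * mu + 2 * rho * K) * (rmax ^ 2 / K))
  with (a * T / (a + 1)).
2:{ unfold a, T, lifetime; field; repeat split; nra. }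
(* The threshold on [w] combines [g * T < a * w], [v < w] and [1 < w]; the constants are the height
   bounds of the largest droplet, divided by [a + 1]. *)
apply (is_lim_p_infty_of_bounds_inv _ _
  (- (a * T + g * T ^ 2 + T) / (a + 1)) (T * v / (a + 1))
  (Rmax (g * T / a) (Rmax v 1))).
intros w Hw0.
assert (Hw1 := Rle_lt_trans _ _ _ (Rmax_l _ _) Hw0).
assert (Hw2 := Rle_lt_trans _ _ _ (Rmax_r _ _) Hw0).
assert (Hvw := Rle_lt_trans _ _ _ (Rmax_l _ _) Hw2).
assert (Hw := Rle_lt_trans _ _ _ (Rmax_r _ _) Hw2).
apply (Rmult_lt_compat_l a) in Hw1; [|exact Ha].
replace (a * (g * T / a)) with (g * T) in Hw1 by (field; lra).
assert (Hs : 0 < T / w) by (apply Rdiv_lt_0_compat; lra).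
assert (Hs1 : T / w < T).
{ assert (T / w * w = T) by (field; lra); nra. }
destruct (trajectory_droplet_motion rho mu g v K rmax w (z rmax w)) as [p Hp];
  [lra | lra | lra | apply Hz; lra |].
fold a T in Hp.
assert (Hb : (a * w * T - (a * T + g * T ^ 2 + T)) / (a + 1)
             <= max_height K rmin rmax z w
             <= (T * v + a * w * T) / (a + 1)).
{ apply (real_Lub_Rbar_bounds _ (z rmax w (T - T / w))).
  - exists rmax, T, (T - T / w); repeat split; try lra.
    (* The height stays positive, so the flight lasts the whole lifetime and includes the time
       [T - T / w]. *)
    right; split; [|reflexivity].
    intros [t [Ht Ht0]]; fold T in Ht.
    assert (Hpos := height_pos a T g v w _ _ Hg Hv Hp t Hw1 Ht).
    cbn beta in Hpos; rewrite Rmax_right in Hpos; lra.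
  - apply Rle_div_l; [lra|].
    assert (L := height_lower_bound a T g v w _ _ HT Hg Hv Hp
                   (Rlt_le _ _ Hvw) Hw).
    cbn beta in L; rewrite Rmax_right in L; lra.
  - intros y [r [zeta [t [Hr [Hzeta [Ht ->]]]]]].
    apply is_duration_le_lifetime in Hzeta.
    destruct (trajectory_droplet_motion rho mu g v K r w (z r w)) as [q Hq];
      [lra | lra | lra | apply Hz; lra |].
    (* Lifetimes grow with the radius, so the wind threshold and the upper bound for [rmax] serve
       every [r]. *)
    assert (HTle : lifetime K r <= T) by (apply lifetime_le; lra).
    apply Rle_div_r; [lra|].
    assert (U := height_upper_bound a _ g v w _ _ Hg Hv Hq t).
    cbn beta in U; rewrite Rmax_right in U by lra.
    assert (0 < a * w) by (apply Rmult_lt_0_compat; lra).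
    assert (a * w * lifetime K r <= a * w * T)
      by (apply Rmult_le_compat_l; lra).
    assert (lifetime K r * v <= T * v) by (apply Rmult_le_compat_r; lra).
    assert (g * lifetime K r <= g * T) by (apply Rmult_le_compat_l; lra).
    assert (U' := U ltac:(lra) ltac:(lra) ltac:(lra)).
    lra. }
split.
- apply Rle_div_r; [lra|].
  eapply Rle_trans; [apply Req_le | apply Hb]; field; lra.
- apply Rle_div_l; [lra|].
  eapply Rle_trans; [apply Hb | apply Req_le]; field; lra.
Qed.
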